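(* Let $d,n\ge 1$, let $\mathbf v^1,\dots,\mathbf v^n\in\mathbb R^d$, and let $\mu_{ij}\ge 0$ ($i,j\in\{1,\dots,n\}$, $i\ne j$) satisfy $\mu_{ij}=\mu_{ji}$ for all $i\neq j$. Let $\mathbf f=(f_1,\dots,f_n)$ and $\mathbf g=(g_1,\dots,g_n)$ be two solutions to the system $$\frac{\partial f_i}{\partial t}+\mathbf v^i\cdot\nabla_{\mathbf x}f_i+\sum_{j\ne i}\bigl(\mu_{ij}f_i-\mu_{ji}f_j\bigr)=0,\qquad i=1,\dots,n,\quad \mathbf x\in\mathbb R^d,\ t>0,$$ corresponding to the initial conditions $\mathbf f(\mathbf x,0)=\mathbf f_0(\mathbf x)$ and $\mathbf g(\mathbf x,0)=\mathbf g_0(\mathbf x)$, respectively. If $f_{0,i}\le g_{0,i}$ for all $i=1,\dots,n$, then $$f_i(\mathbf x,t)\le g_i(\mathbf x,t)\qquad\text{for all } i=1,\dots,n$$ for any $t>0$ (for a.e. $\mathbf x\in\mathbb R^d$).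
   Context: Solutions are understood in the mild sense: $\mathbf f\in C([0,\infty);[L^1_{\mathrm{loc}}(\mathbb R^d)]^n)$ and, for every $i$ and every $t\ge 0$, for a.e. $\mathbf x$, $$f_i(\mathbf x+\mathbf v^i t,t)=f_{0,i}(\mathbf x)+\int_0^t\sum_{j\ne i}\bigl(\mu_{ji}f_j-\mu_{ij}f_i\bigr)(\mathbf x+\mathbf v^i s,s)\,ds .$$ Inequalities between initial data hold almost everywhere. *)

(* Defs.v *)
From HB Require Import structures.
From mathcomp Require Import all_boot all_order all_algebra.
From mathcomp Require Import all_classical all_reals all_analysis.

Set Implicit Arguments.
Unset Strict Implicit.
Unset Printing Implicit Defensive.
Import Order.TTheory GRing.Theory Num.Theory numFieldNormedType.Exports.
Local Open Scope classical_set_scope.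
Local Open Scope ring_scope.

(* R^d is 'rV[R]_d, with the sigma-algebra generated by the coordinate maps,
   in the same way as the library equips d.-tuple R.  It is the Borel
   sigma-algebra: see open_measurable_rV. *)
Definition measure_rV_display : measure_display.
Proof. exact: default_measure_display. Qed.

Section measurable_rV.
Context {R : realType} (d : nat).

Let coords : 'I_d -> 'rV[R]_d -> measurableTypeR R := fun i x => x ord0 i.

Let rV_set0 : g_sigma_preimage coords set0.
Proof. exact: sigma_algebra0. Qed.

Let rV_setC A : g_sigma_preimage coords A -> g_sigma_preimage coords (~` A).
Proof. exact: sigma_algebraC. Qed.

Let rV_bigcup (F : _^nat) : (forall i, g_sigma_preimage coords (F i)) ->
  g_sigma_preimage coords (\bigcup_i (F i)).
Proof. exact: sigma_algebra_bigcup. Qed.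

HB.instance Definition _ := @isMeasurable.Build measure_rV_display
  'rV[R]_d (g_sigma_preimage coords) rV_set0 rV_setC rV_bigcup.

Lemma measurable_coord (i : 'I_d) :
  measurable_fun [set: 'rV[R]_d] (fun x => x ord0 i : R).
Proof.
move=> _ Y mY; rewrite setTI; apply: sub_sigma_algebra => /=.
rewrite -bigcup_seq/=; exists i => /=; first by rewrite mem_index_enum.
by exists Y => //; rewrite setTI.
Qed.

Lemma measurable_fun_rVP d1 (T1 : measurableType d1) (f : T1 -> 'rV[R]_d) :
  measurable_fun [set: T1] f <->
  forall i, measurable_fun [set: T1] (fun x => f x ord0 i : R).
Proof.
split=> [mf i|mf].
  by apply: (measurableT_comp (measurable_coord i)).
suff H : g_sigma_preimage (fun i => coords i \o f) `<=` measurable.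
  by rewrite g_sigma_preimage_comp in H; move=> _ A mA; apply: H; exists A.
apply: smallest_sub; first exact: sigma_algebra_measurable.
rewrite -bigcup_seq; apply: bigcup_sub => i _ A [B mB <-].
exact: mf.
Qed.

End measurable_rV.

Section lebesgue_rV.
Context {R : realType}.

Definition rV_cons (d : nat) (p : measurableTypeR R * 'rV[R]_d) :
  'rV[R]_d.+1 := \row_i oapp (p.2 ord0) (p.1 : R) (unlift ord0 i).

Lemma rV_cons0 d p : @rV_cons d p ord0 ord0 = p.1.
Proof. by rewrite mxE unlift_none. Qed.

Lemma rV_consS d p i : @rV_cons d p ord0 (lift ord0 i) = p.2 ord0 i.
Proof. by rewrite mxE liftK. Qed.

Lemma measurable_rV_cons d : measurable_fun setT (@rV_cons d).
Proof.
apply/measurable_fun_rVP => i; case: (unliftP ord0 i) => [j|] ->.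
  under eq_fun do rewrite rV_consS.
  by apply: (measurableT_comp (measurable_coord j)); exact: measurable_snd.
under eq_fun do rewrite rV_cons0.
exact: measurable_fst.
Qed.

Section step.
Variables (d : nat) (mu : {sigma_finite_measure set 'rV[R]_d -> \bar R}).

Definition lebesgue_rV_step : set 'rV[R]_d.+1 -> \bar R :=
  pushforward (@lebesgue_measure R \x mu)%E (@rV_cons d).

Let mcons A : measurable A -> measurable (@rV_cons d @^-1` A).
Proof.
by move=> mA; rewrite -[X in measurable X]setTI; exact: measurable_rV_cons.
Qed.

Let step0 : lebesgue_rV_step set0 = 0%E.
Proof. by rewrite /lebesgue_rV_step /pushforward preimage_set0 measure0. Qed.

Let step_ge0 A : (0 <= lebesgue_rV_step A)%E.
Proof. by rewrite /lebesgue_rV_step /pushforward measure_ge0. Qed.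

Let step_sigma_additive : semi_sigma_additive lebesgue_rV_step.
Proof.
move=> F mF tF mUF; rewrite /lebesgue_rV_step /pushforward preimage_bigcup.
apply: measure_semi_sigma_additive.
- by move=> n; exact: mcons.
- apply/trivIsetP => /= i j _ _ ij; rewrite -preimage_setI.
  by move/trivIsetP : tF => /(_ _ _ _ _ ij) ->//; rewrite preimage_set0.
- by rewrite -preimage_bigcup; exact: mcons.
Qed.

HB.instance Definition _ := isMeasure.Build _ _ _
  lebesgue_rV_step step0 step_ge0 step_sigma_additive.

Let step_sigma_finite : sigma_finite setT lebesgue_rV_step.
Proof.
have /sigma_finiteP[F [FT ndF Foo]] := sigma_finiteT (@lebesgue_measure R).
have /sigma_finiteP[G [GT ndG Goo]] := sigma_finiteT mu.
pose u (x : 'rV[R]_d.+1) : measurableTypeR R * 'rV[R]_d :=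
  (x ord0 ord0, \row_i x ord0 (lift ord0 i)).
have m_u : measurable_fun setT u.
  apply/measurable_fun_pairP; split; first exact: measurable_coord.
  apply/measurable_fun_rVP => i; rewrite /u/=.
  by under eq_fun do rewrite mxE; exact: measurable_coord.
have consK : cancel (@rV_cons d) u.
  move=> [a v]; rewrite /u rV_cons0; congr pair.
  by apply/rowP => i; rewrite mxE rV_consS.
exists (fun k => u @^-1` (F k `*` G k)).
  rewrite -preimage_bigcup [X in _ @^-1` X](_ : _ = setT) ?preimage_setT//.
  rewrite -setXTT FT GT predeqE => -[x y]; split.
    by move=> [n _ []/= ? ?]; split; exists n.
  move=> [/= [n _ Fnx] [k _ Gky]]; exists (maxn n k) => //; split.
  - by move: x Fnx; exact/subsetPset/ndF/leq_maxl.
  - by move: y Gky; exact/subsetPset/ndG/leq_maxr.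
move=> k; have [mF ?] := Foo k; have [mG ?] := Goo k; split.
  by rewrite -[X in measurable X]setTI; apply: m_u => //; exact: measurableX.
rewrite /lebesgue_rV_step /pushforward -comp_preimage.
rewrite (_ : u \o @rV_cons d = id); last exact/funext.
by rewrite preimage_id product_measure1E// lte_mul_pinfty// ge0_fin_numE.
Qed.

HB.instance Definition _ := Measure_isSigmaFinite.Build _ _ _
  lebesgue_rV_step step_sigma_finite.

End step.

(* Product of d copies of the Lebesgue measure on R. *)
Fixpoint lebesgue_rV (d : nat) :
    {sigma_finite_measure set 'rV[R]_d -> \bar R} :=
  match d with
  | 0 => @dirac _ _ (0 : 'rV[R]_0) R
  | d'.+1 => lebesgue_rV_step (lebesgue_rV d')
  end.

End lebesgue_rV.

Lemma lebesgue_rV_box (R : realType) (d : nat) (a b : 'I_d -> R) :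
  (forall i, a i <= b i) ->
  lebesgue_rV d [set x : 'rV[R]_d | forall i, a i <= x ord0 i <= b i] =
  (\prod_(i < d) (b i - a i))%:E.
Proof.
elim: d a b => [|d IH] a b ab.
  rewrite big_ord0 /= diracE mem_set//; by case.
rewrite /= /lebesgue_rV_step /pushforward big_ord_recl.
pose B := [set x : 'rV[R]_d |
  forall i, a (lift ord0 i) <= x ord0 i <= b (lift ord0 i)].
rewrite [X in product_measure1 _ _ X](_ : _ = `[a ord0, b ord0] `*` B).
  have mB : measurable B.
    rewrite /B [X in measurable X](_ : _ = \big[setI/setT]_(i < d)
      ((fun x : 'rV[R]_d => x ord0 i : R) @^-1`
        `[a (lift ord0 i), b (lift ord0 i)])); last first.
      rewrite -bigcap_seq predeqE => x /=; split=> [xB i _|xB i].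
        by rewrite /= in_itv; exact: xB.
      by have := xB i; rewrite /= in_itv; apply; rewrite mem_index_enum.
    apply: bigsetI_measurable => i _.
    rewrite -[X in measurable X]setTI; apply: measurable_coord => //.
  rewrite product_measure1E// EFinM IH => [|i]; last exact: ab.
  have /= -> := lebesgue_measure_itv `[a ord0, b ord0]; rewrite lte_fin.
  have := ab ord0; rewrite le_eqVlt => /predU1P[->|->//].
  by rewrite ltxx subrr.
rewrite predeqE => -[y x]; split=> /= [H|[Hy Hx] i].
  split; first by have := H ord0; rewrite rV_cons0 in_itv.
  by move=> i; have := H (lift ord0 i); rewrite rV_consS.
case: (unliftP ord0 i) => [j|] ->; first by rewrite rV_consS; exact: Hx.
by rewrite rV_cons0; move: Hy; rewrite in_itv.
Qed.

Lemma open_measurable_rV (R : realType) (d : nat) (A : set 'rV[R]_d) :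
  open A -> measurable A.
Proof.
move=> oA.
pose B (q : {ffun 'I_d -> rat * rat}) := [set x : 'rV[R]_d |
  forall i, x ord0 i \in `]ratr (q i).1, ratr (q i).2[].
have mB q : measurable (B q).
  rewrite [X in measurable X](_ : _ = \big[setI/setT]_(i < d)
    ((fun x : 'rV[R]_d => x ord0 i : R) @^-1`
      `]ratr (q i).1, ratr (q i).2[)); last first.
    rewrite -bigcap_seq predeqE => x /=; split=> [xB i _|xB i].
      exact: xB.
    by have := xB i; apply; rewrite /= mem_index_enum.
  apply: bigsetI_measurable => i _.
  by rewrite -[X in measurable X]setTI; apply: measurable_coord.
rewrite (_ : A = \bigcup_(q in [set q | B q `<=` A]) B q).
  rewrite bigcup_mkcond; apply: countable_bigcupT_measurable => [|q].
    exact: countableP.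
  by case: ifP.
rewrite predeqE => x; split=> [Ax|[q /= qA /qA]//].
have /nbhs_ballP[e /= e0 xeA] : nbhs x A by exact: open_nbhs_nbhs.
have /choice[q Hq] : forall i, exists q : rat * rat,
    x ord0 i - e < ratr q.1 < x ord0 i /\ x ord0 i < ratr q.2 < x ord0 i + e.
  move=> i.
  have /rat_in_itvoo[q1] : x ord0 i - e < x ord0 i by rewrite gtrBl.
  have /rat_in_itvoo[q2] : x ord0 i < x ord0 i + e by rewrite ltrDl.
  by rewrite !in_itv/= => H2 H1; exists (q1, q2).
exists [ffun i => q i].
  move=> y /= yB; apply: xeA; split => // i j; rewrite (ord1 i).
  have := yB j; rewrite ffunE in_itv/= => /andP[y1 y2].
  have [/andP[h1 h2] /andP[h3 h4]] := Hq j.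
  rewrite /ball/= ltr_distlC; apply/andP; split.
    exact: lt_trans y1.
  exact: lt_trans h4.
move=> i; rewrite ffunE in_itv/=.
by have [/andP[_ ->] /andP[-> _]] := Hq i.
Qed.

Section mild_solution.
Context {R : realType} (d n : nat).
Local Notation leb := (lebesgue_rV d).

Definition locally_integrable_rV (f : 'rV[R]_d -> R) : Prop :=
  measurable_fun setT f /\
  forall K : set 'rV[R]_d,
    compact K -> (\int[leb]_(x in K) `|f x|%:E < +oo)%E.

(* u \in C([0, oo); L^1_loc(R^d)), the topology of L^1_loc being given by the
   seminorms f |-> \int_K |f|, K compact.  Elements of L^1_loc are represented
   by measurable functions. *)
Definition continuous_L1loc (u : R -> 'rV[R]_d -> R) : Prop :=
  (forall t : R, 0 <= t -> locally_integrable_rV (u t)) /\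
  (forall t : R, 0 <= t -> forall K : set 'rV[R]_d, compact K ->
    (\int[leb]_(x in K) `|u s x - u t x|%:E)%E
      @[s --> within [set s : R | 0 <= s] (nbhs t)] --> 0%E).

(* Changing each f i s on a null set depending on s does not change f as a curve
   in [L^1_loc]^n but may make s |-> f j s (x + s *: v i) non-measurable.  The
   integral along the characteristic is therefore computed with a version F of f
   that is jointly measurable in (s, x): any f satisfying the continuity
   condition has one, and two of them give the same integral for a.e. x. *)
Definition mild_solution (v : 'I_n -> 'rV[R]_d) (mu : 'I_n -> 'I_n -> R)
    (f0 : 'I_n -> 'rV[R]_d -> R) (f : 'I_n -> R -> 'rV[R]_d -> R) : Prop :=
  (forall i, continuous_L1loc (f i)) /\
  exists F : 'I_n -> R -> 'rV[R]_d -> R,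
  [/\ forall i, measurable_fun
        [set p : measurableTypeR R * 'rV[R]_d | (0 : R) <= p.1]
        (fun p : measurableTypeR R * 'rV[R]_d => F i p.1 p.2),
      forall i (t : R), 0 <= t -> {ae leb, forall x, F i t x = f i t x}
    & forall i (t : R), 0 <= t -> {ae leb, forall x,
        f i t (x + t *: v i) = f0 i x +
          \int[lebesgue_measure]_(s in `[0, t])
            \sum_(j < n | j != i) (mu j i * F j s (x + s *: v i)
                                   - mu i j * F i s (x + s *: v i))}].

End mild_solution.

(* Main.v *)
Require Import Defs.
From HB Require Import structures.
From mathcomp Require Import all_boot all_order all_algebra.
From mathcomp Require Import all_classical all_reals all_analysis.
From mathcomp Require Import measurable_realfun ring.

(* By linearity it is enough to show that a mild solution h with nonnegative
   initial data stays nonnegative.  For a.e. x, y(s) = h_i(x + s v_i, s) is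
   absolutely continuous and y' = -l y + sum_j mu_ji h_j with l >= 0, so its
   negative part satisfies
     y^-(t) <= int_0^t sum_j mu_ji h_j^-(x + s v_i, s) ds.
   As h is only locally integrable, this is integrated over balls which shrink in
   time at least as fast as the characteristics move.  The resulting quantities
   m_i(t) = int_{K(t)} h_i^-(., t) are bounded on [0, T] and satisfy
   m_i(t) <= C int_0^t max_j m_j, hence vanish by Gronwall's argument. *)

Import Order.TTheory GRing.Theory Num.Theory numFieldNormedType.Exports.
Local Open Scope classical_set_scope.
Local Open Scope ring_scope.

(** * Translation invariance of Lebesgue measure *)

(** The translated measure gives every half-open interval its length, and Lebesgue measure is the
    only measure that does so. *)
Lemma lebesgue_measure_shift (R : realType) (c : R) (A : set R) :
  measurable A ->
  lebesgue_measure ((fun x : R => x + c) @^-1` A) = lebesgue_measure A.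
Proof.
move=> mA.
pose shift_c (x : measurableTypeR R) : measurableTypeR R := x + c.
have mshift : measurable_fun setT shift_c.
  by apply: measurable_funD => //; exact: measurable_id.
have := @lebesgue_measure_unique R (pushforward lebesgue_measure shift_c).
move=> /(_ mshift) uniq; rewrite [RHS]uniq// => X [[a b] /= _ <-].
rewrite /pushforward.
rewrite (_ : _ @^-1` _ = `]a - c, b - c]%classic).
  by rewrite !lebesgue_measure_itv/= !lte_fin ltrD2r -!EFinB opprB addrA subrK.
by apply/seteqP; split=> x /=; rewrite !in_itv/= ltrBlDr lerBrDr.
Qed.

Section shift_rV.
Context {R : realType}.

Lemma measurable_rV_shift (d : nat) (c : 'rV[R]_d) :
  measurable_fun setT (fun x : 'rV[R]_d => x + c).
Proof.
apply/measurable_fun_rVP => i; under eq_fun do rewrite mxE.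
by apply: measurable_funD => //; exact: measurable_coord.
Qed.

(** Induction on the dimension: the translation acts on the tail of a vector, where the induction
    hypothesis applies to each section, and on its first coordinate, where one-dimensional
    invariance applies to the outer integral. *)
Lemma lebesgue_rV_shift (d : nat) (c : 'rV[R]_d) (A : set 'rV[R]_d) :
  measurable A ->
  lebesgue_rV d ((fun x => x + c) @^-1` A) = lebesgue_rV d A.
Proof.
elim: d c A => [|d IH] c A mA.
  rewrite (_ : (fun x => x + c) = id) ?preimage_id//.
  by apply/funext => x; apply/rowP => -[].
pose B := @rV_cons R d @^-1` A.
have mB : measurable B.
  by rewrite -[B]setTI; exact: measurable_rV_cons.
have mx a : measurable (xsection B a) by exact: measurable_xsection.
pose c' : 'rV[R]_d := \row_i c ord0 (lift ord0 i).
rewrite /= /lebesgue_rV_step /pushforward.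
pose phi (a : measurableTypeR R) := lebesgue_rV d (xsection B a).
transitivity (\int[lebesgue_measure]_(a in setT) phi (a + c ord0 ord0)%R)%E.
  apply: eq_integral => a _ /=.
  rewrite /phi -[RHS](IH c') ?mx//.
  congr (lebesgue_rV d _).
  suff E y : @rV_cons R d (a, y) + c = rV_cons (a + c ord0 ord0, y + c').
    by apply/seteqP; split=> y; rewrite /xsection /B /= !inE /= E.
  apply/rowP => i; rewrite !mxE; case: (unliftP ord0 i) => [j|] -> /=.
    by rewrite !mxE.
  by [].
pose shift_c (x : measurableTypeR R) : measurableTypeR R := x + c ord0 ord0.
have mshift : measurable_fun setT shift_c.
  by apply: measurable_funD => //; exact: measurable_id.
have mphi : measurable_fun setT phi by exact: measurable_fun_xsection.
(* The product measure of [B] is by definition the integral of the measures of its sections. *)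
rewrite -[RHS]/(\int[lebesgue_measure]_(a in setT) phi a)%E.
transitivity (\int[pushforward lebesgue_measure shift_c]_(a in setT) phi a)%E.
  by rewrite ge0_integral_pushforward//.
apply: eq_measure_integral => /= X mX _.
exact: lebesgue_measure_shift.
Qed.

Lemma ge0_integral_rV_shift (d : nat) (c : 'rV[R]_d) (f : 'rV[R]_d -> \bar R) :
  measurable_fun setT f -> (forall x, 0 <= f x)%E ->
  (\int[lebesgue_rV d]_x f (x + c)%R = \int[lebesgue_rV d]_x f x)%E.
Proof.
move=> mf f0.
pose shift_c (x : 'rV[R]_d) := x + c.
transitivity (\int[pushforward (lebesgue_rV d) shift_c]_(x in setT) f x)%E.
  rewrite ge0_integral_pushforward//; exact: measurable_rV_shift.
apply: eq_measure_integral => /= [|_ X mX _]; first exact: measurable_rV_shift.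
exact: lebesgue_rV_shift.
Qed.

Lemma ae_rV_shift (d : nat) (c : 'rV[R]_d) (P : set 'rV[R]_d) :
  {ae lebesgue_rV d, forall x, P x} -> {ae lebesgue_rV d, forall x, P (x + c)}.
Proof.
move=> [N [mN N0 PN]]; exists ((fun x => x + c) @^-1` N); split.
- by rewrite -[X in measurable X]setTI; exact: measurable_rV_shift.
- by rewrite lebesgue_rV_shift.
- by move=> x /= nP; exact: PN.
Qed.

End shift_rV.

(** * A scalar integral inequality with damping *)

Section nonneg_ode.
Context {R : realType}.
Local Notation leb := (@lebesgue_measure R).

(* If [y s := y0 + \int_0^s a] is negative at [t], let [tau] be its last zero:
   on [(tau, t]] the damping term [- l * y] is nonnegative, so that only [p]
   can drive [y] down. *)
Lemma opp_integral_le_of_damping (t y0 l : R) (a p : R -> R) :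
  0 <= t -> 0 <= y0 -> 0 <= l ->
  leb.-integrable `[0, t] (EFin \o a) -> leb.-integrable `[0, t] (EFin \o p) ->
  (forall s, 0 <= p s) ->
  {ae leb, forall s, `[0, t]%classic s ->
     - p s - l * (y0 + \int[leb]_(r in `[0, s]) a r) <= a s} ->
  - (y0 + \int[leb]_(s in `[0, t]) a s) <= \int[leb]_(s in `[0, t]) p s.
Proof.
move=> t0 y00 l0 ia ip p0 ineq.
pose y s := y0 + \int[leb]_(r in `[0, s]) a r.
rewrite -/(y t).
have ip0 : 0 <= \int[leb]_(s in `[0, t]) p s by exact: Rintegral_ge0.
have [yt0|yt0] := leP 0 (y t); first by apply: le_trans ip0; rewrite oppr_le0.
pose S := [set s | `[0, t]%classic s /\ 0 <= y s].
have S0 : S 0.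
  split; first by rewrite /= in_itv/= lexx.
  by rewrite /y set_itv1 Rintegral_set1 addr0.
have ubS : ubound S t by move=> s -[/=]; rewrite in_itv/= => /andP[].
have supS : has_sup S by split; [exists 0|exists t].
set tau := sup S.
have tau0 : 0 <= tau by exact: (ub_le_sup supS.2).
have taut : tau <= t by apply: ge_sup => //; exists 0.
have tauI : `[0, t]%classic tau by rewrite /= in_itv/= tau0.
have ytau : 0 <= y tau.
  (* Otherwise continuity would make [y] negative near [tau] in [[0, t]], although points of [S] lie
     arbitrarily close to [tau]. *)
  rewrite leNgt; apply/negP => ytau.
  have cy : {within `[0, t], continuous y}.
    move=> s; apply: cvgD; first exact: cvg_cst.
    exact: (parameterized_integral_continuous t0 ia).
  have : \forall s \near within `[0, t] (nbhs tau), y s < 0.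
    have := cy tau; rewrite /continuous_at.
    by case: (nbhs_subspaceP `[0, t]%classic tau) => // _ /cvgr_lt; exact.
  move=> /nbhs_ballP[e /= e0 he].
  have [s Ss] := sup_adherent e0 supS.
  rewrite -/tau => taus.
  have stau : s <= tau by exact: (ub_le_sup supS.2).
  have := he s; rewrite /ball/= ger0_norm ?subr_ge0// ltrBlDl -ltrBlDr.
  by move=> /(_ taus Ss.1); rewrite ltNge Ss.2.
have yneg s : `]tau, t]%classic s -> y s <= 0.
  move=> /= ; rewrite in_itv/= => /andP[taus st]; rewrite leNgt; apply/negP => ys.
  suff : s <= tau by rewrite leNgt taus.
  apply: (ub_le_sup supS.2); split; last exact: ltW.
  by rewrite /= in_itv/= st (le_trans tau0 (ltW taus)).
have sub : `]tau, t] `<=` `[0, t]%classic.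
  by apply: subset_itvr; rewrite bnd_simp.
have iA : leb.-integrable `]tau, t] (EFin \o a) by exact: integrableS ia.
have iP : leb.-integrable `]tau, t] (EFin \o p) by exact: integrableS ip.
have Ea : y t - y tau = \int[leb]_(s in `]tau, t]) a s.
  by rewrite /y opprD addrACA subrr add0r; apply: Rintegral_itvB.
have Ep : \int[leb]_(s in `[0, t]) p s - \int[leb]_(s in `[0, tau]) p s =
          \int[leb]_(s in `]tau, t]) p s by apply: Rintegral_itvB.
(* On []tau, t]] the bound [a + p >= - l * y >= 0] holds only almost everywhere, so the integrand is
   first replaced by its absolute value. *)
have : 0 <= \int[leb]_(s in `]tau, t]) (a s + p s).
  rewrite (_ : Rintegral _ _ _ = \int[leb]_(s in `]tau, t]) `|a s + p s|).
    exact: Rintegral_ge0.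
  congr fine; apply: ae_eq_integral => //.
  - exact: measurable_int (integrableD _ iA iP).
  - apply/measurable_EFinP; apply: measurableT_comp => //.
    by apply/measurable_EFinP; exact: measurable_int (integrableD _ iA iP).
  apply: (@filterS _ (almost_everywhere leb) (ae_filter_ringOfSetsType leb)
    _ _ _ ineq) => s hs sI.
  rewrite ger0_norm// -lerBlDr sub0r; apply: le_trans (hs (sub _ sI)).
  by rewrite lerDl oppr_ge0 mulr_ge0_le0//; exact: yneg.
rewrite RintegralD// -Ea -Ep => H.
have ptau : 0 <= \int[leb]_(s in `[0, tau]) p s by exact: Rintegral_ge0.
rewrite -subr_ge0 opprK; apply: le_trans H _.
rewrite addrC lerD//; first by rewrite gerBl.
by rewrite gerBl.
Qed.

End nonneg_ode.

(** * Measurability and null sets on product spaces *)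

Section product_ae.
Context {d1 d2} {T1 : measurableType d1} {T2 : measurableType d2} {R : realType}.

(** Tonelli's theorem makes the integrals of the positive and negative parts measurable in [x];
    [fine] of their difference is then measurable too, infinite values included. *)
Lemma measurable_Rintegral_snd (m2 : {sigma_finite_measure set T2 -> \bar R})
    (f : T1 * T2 -> R) :
  measurable_fun setT f ->
  measurable_fun setT (fun x => \int[m2]_y f (x, y)).
Proof.
move=> /measurable_EFinP mf; apply: measurableT_comp => /=.
  exact: measurable_realfun.fine_measurable.
rewrite (_ : (fun x => _) =
    (fun x => \int[m2]_y (EFin \o f)^\+ (x, y) -
              \int[m2]_y (EFin \o f)^\- (x, y))%E).
  apply: emeasurable_funB.
    exact: (measurable_fun_fubini_tonelli_F _ (measurable_funepos mf)).
  exact: (measurable_fun_fubini_tonelli_F _ (measurable_funeneg mf)).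
apply/funext => x; rewrite integralE.
by congr (_ - _)%E; apply: eq_integral => y _; rewrite ?funeposE ?funenegE.
Qed.

(** By Tonelli's theorem, both sides say that the complement of [B] is null for the product
    measure. *)
Lemma ae_ae_swap (m1 : {sigma_finite_measure set T1 -> \bar R})
    (m2 : {sigma_finite_measure set T2 -> \bar R}) (B : set (T1 * T2)) :
  measurable B ->
  {ae m1, forall x, {ae m2, forall y, B (x, y)}} ->
  {ae m2, forall y, {ae m1, forall x, B (x, y)}}.
Proof.
move=> mB aeB.
have mC : measurable (~` B) by exact: measurableC.
have E : (\int[m2]_y (m1 \o ysection (~` B)) y = 0)%E.
  rewrite -(indic_fubini_tonelli_GE m1) //.
  apply: (etrans (esym (indic_fubini_tonelli m1 m2 mC))).
  rewrite (indic_fubini_tonelli_FE m2) //.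
  rewrite -[RHS](@integral0 _ _ _ m1 setT); apply: ae_eq_integral => //.
    exact: measurable_fun_xsection.
  move: aeB; apply: filterS => x [N [mN N0 BN]] _.
  apply/eqP; rewrite -measure_le0 -N0 /=; apply: le_measure; rewrite ?inE//.
    exact: measurable_xsection.
  by move=> y; rewrite /xsection /= inE => nB; exact: BN.
have : (\int[m2]_y `|(m1 \o ysection (~` B)) y| = 0)%E.
  by rewrite -[RHS]E; apply: eq_integral => y _; rewrite gee0_abs.
move/(ae_eq_integral_abs _ measurableT).
move=> /(_ (measurable_fun_ysection _ mC)); apply: filterS => y /(_ I) /= my0.
exists (ysection (~` B) y); split => //; first exact: measurable_ysection.
by move=> x /= nB; rewrite /ysection/= inE.
Qed.

End product_ae.

(** * Compact sets and uniform bounds in L^1_loc *)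

Section ball_rV.
Context {R : realType} {d : nat}.

Lemma compact_measurable_rV (K : set 'rV[R]_d) : compact K -> measurable K.
Proof.
move=> cK; rewrite -[K]setCK; apply: measurableC; apply: open_measurable_rV.
by apply: closed_openC; apply: compact_closed => //; exact: norm_hausdorff.
Qed.

Lemma norm_ball_compact (r : R) : compact [set x : 'rV[R]_d | `|x| <= r].
Proof.
apply: bounded_closed_compact.
  by exists r; split; [exact: num_real|move=> M rM x /= xr; exact: le_trans (ltW rM)].
rewrite (_ : mkset _ = (fun x : 'rV[R]_d => `|x|) @^-1` [set s | s <= r])//.
by apply: closed_comp; [move=> x _; exact: norm_continuous|exact: closed_le].
Qed.

End ball_rV.

Section L1loc.
Context {R : realType} {d : nat}.
Local Notation leb := (@lebesgue_rV R d).
Local Notation leb1 := (@lebesgue_measure R).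

(** Near each [t], the triangle inequality bounds the norm by that of [u t] plus 1; compactness of
    [[0, T]] makes the bound uniform. *)
Lemma continuous_L1loc_bounded (u : R -> 'rV[R]_d -> R) (K : set 'rV[R]_d)
    (T : R) :
  continuous_L1loc u -> compact K ->
  exists M : R, forall t, 0 <= t <= T ->
    (\int[leb]_(x in K) `|u t x|%:E <= M%:E)%E.
Proof.
move=> [lu cu] cK; have mK := compact_measurable_rV _ cK.
have mu t : 0 <= t -> measurable_fun K (u t).
  by move=> t0; apply: measurable_funTS; exact: (lu t t0).1.
have loc (t : R) : 0 <= t -> exists M : R, \forall s \near t,
    0 <= s -> (\int[leb]_(x in K) `|u s x|%:E <= M%:E)%E.
  move=> t0; exists (1 + fine (\int[leb]_(x in K) `|u t x|%:E)%E).
  have /fine_cvgP[fin_near cv] := cu t t0 K cK.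
  have lt1 : \forall s \near within [set s : R | 0 <= s] (nbhs t),
      fine (\int[leb]_(x in K) `|u s x - u t x|%:E)%E < 1 by exact: cvgr_lt cv _ ltr01.
  have {}fin_near : \forall s \near t, 0 <= s ->
      (\int[leb]_(x in K) `|u s x - u t x|%:E)%E \is a fin_num by exact: fin_near.
  have {}lt1 : \forall s \near t, 0 <= s ->
      fine (\int[leb]_(x in K) `|u s x - u t x|%:E)%E < 1 by exact: lt1.
  apply: filterS2 lt1 fin_near => s ls fs s0.
  have {}ls := ls s0; have {}fs := fs s0.
  have ft : (\int[leb]_(x in K) `|u t x|%:E)%E \is a fin_num.
    by rewrite ge0_fin_numE ?integral_ge0//; exact: (lu t t0).2.
  apply: (@le_trans _ _ (\int[leb]_(x in K) (`|u s x - u t x|%:E + `|u t x|%:E))%E).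
    apply: ge0_le_integral => //.
    - by apply/measurable_EFinP; apply: measurableT_comp => //; exact: mu.
    - apply: emeasurable_funD; apply/measurable_EFinP; apply: measurableT_comp => //.
        by apply: measurable_funB; exact: mu.
      exact: mu.
    - move=> x _; rewrite -EFinD lee_fin.
      by rewrite -[X in `|X| <= _](subrK (u t x)) ler_normD.
  rewrite ge0_integralD//.
  - by rewrite EFinD fineK// leeD// -(fineK fs) lee_fin ltW.
  - apply/measurable_EFinP; apply: measurableT_comp => //.
    by apply: measurable_funB; exact: mu.
  - by apply/measurable_EFinP; apply: measurableT_comp => //; exact: mu.
(* Compactness is used in its near-covering form, with the bound as a parameter tending to infinity.
   This yields an [M] such that every number strictly above it is a bound on all of [[0, T]], whence
   the choice of [M + 1]. *)
have /compact_near_coveringP cov := @segment_compact R 0 T.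
have := @cov R (pinfty_nbhs R)
  (fun M s => 0 <= s -> (\int[leb]_(x in K) `|u s x|%:E <= M%:E)%E) _.
case=> [t|M [_ /(_ (M + 1))]].
  rewrite /= in_itv/= => /andP[/loc[M near_t] _].
  exists ((fun s : R => 0 <= s -> (\int[leb]_(x in K) `|u s x|%:E <= M%:E)%E),
          [set N | M <= N]).
    by split => //=; apply: nbhs_pinfty_ge; exact: num_real.
  move=> [s N] /= [Hs MN] s0; apply: le_trans (Hs s0) _.
  by rewrite lee_fin.
rewrite ltrDl ltr01 => /(_ isT) H; exists (M + 1) => t /andP[t0 tT].
by apply: H => //=; rewrite in_itv/= t0.
Qed.

End L1loc.

(** * Integrability along characteristics *)

Section characteristics.
Context {R : realType} {d : nat}.
Local Notation leb := (@lebesgue_rV R d).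
Local Notation leb1 := (@lebesgue_measure R).
Local Notation space_time := (measurableTypeR R * 'rV[R]_d)%type.

Lemma measurable_along_characteristic (F : R -> 'rV[R]_d -> R) (v : 'rV[R]_d) :
  measurable_fun setT (fun p : space_time => F p.1 p.2) ->
  measurable_fun setT (fun p : space_time => F p.1 (p.2 + (p.1 : R) *: v)).
Proof.
move=> mF.
pose sh (p : space_time) : space_time := (p.1, p.2 + (p.1 : R) *: v).
suff msh : measurable_fun setT sh by exact: (measurableT_comp mF msh).
apply/measurable_fun_pairP; split; first exact: measurable_fst.
apply/measurable_fun_rVP => i; rewrite /sh /=.
under eq_fun do rewrite !mxE.
apply: measurable_funD.
  by apply: (measurableT_comp (measurable_coord i)); exact: measurable_snd.
by apply: measurable_funM; [exact: measurable_fst|exact: measurable_cst].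
Qed.

(** For [x] in the ball of radius [k] and [s] in [[0, T]], the point [x + s *: v] stays in the ball
    of radius [k + T * |v|], on which the norm of [F s] is bounded uniformly in [s]. Hence the
    function is integrable on the product of [[0, T]] and the small ball, and Fubini's theorem gives
    integrability in [s] for a.e. [x]. *)
Lemma ae_integrable_characteristic (F : R -> 'rV[R]_d -> R) (v : 'rV[R]_d)
    (T : R) :
  measurable_fun setT (fun p : space_time => F p.1 p.2) ->
  (forall K, compact K -> exists M : R, forall t, 0 <= t <= T ->
    (\int[leb]_(x in K) `|F t x|%:E <= M%:E)%E) ->
  {ae leb, forall x,
    leb1.-integrable `[0, T] (fun s => (F s (x + s *: v))%:E)}.
Proof.
move=> mF bF.
have mFv := measurable_along_characteristic _ v mF.
pose B (r : R) := [set x : 'rV[R]_d | `|x| <= r].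
have mB r : measurable (B r).
  by apply: compact_measurable_rV; exact: norm_ball_compact.
(* Countably many balls of integer radius cover the space. *)
suff H (k : nat) : {ae leb, forall x, B k%:R x ->
    leb1.-integrable `[0, T] (fun s => (F s (x + s *: v))%:E)}.
  have := @ae_foralln _ _ _ leb _ H; apply: filterS => x /(_ (Num.truncn `|x|).+1).
  by apply; rewrite /B/= ltW// truncnS_gt.
pose phi (p : space_time) :=
  F p.1 (p.2 + (p.1 : R) *: v) *
  \1_(`[0, T]%classic : set R) p.1 * \1_(B k%:R) p.2.
have mphi : measurable_fun setT phi.
  apply: measurable_funM; first apply: measurable_funM => //.
    by apply: (measurableT_comp _ measurable_fst); exact: measurable_indic.
  by apply: (measurableT_comp _ measurable_snd); exact: measurable_indic.
have [M HM] := bF _ (norm_ball_compact (k%:R + T * `|v|)).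
have mFt t : measurable_fun setT (F t) by exact: (measurable_fun_pair2 t mF).
have phi_le (s : R) : (\int[leb]_x `|(phi (s, x))%:E| <=
    (M%:E * (\1_(`[0, T]%classic : set R) s)%:E))%E.
  rewrite /phi /= indicE; case: (boolP (s \in _)) => [|_]; last first.
    by rewrite integral0_eq ?mule0// => x _; rewrite mulr0 mul0r normr0.
  rewrite inE/= in_itv/= mule1 => /andP[s0 sT].
  pose h x := (`|F s x| * \1_(B (k%:R + T * `|v|)) x)%:E.
  have mh : measurable_fun setT h.
    apply/measurable_EFinP; apply: measurable_funM; first exact: measurableT_comp.
    exact: measurable_indic.
  (* The indicator of the small ball at [x] is at most that of the large ball at [x + s *: v];
     translation invariance then removes the shift. *)
  apply: le_trans (_ : \int[leb]_x h (x + s *: v)%R <= _)%E.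
    apply: ge0_le_integral => //=.
    - apply/measurable_EFinP; apply: measurableT_comp => //.
      apply: measurable_funM; last exact: measurable_indic.
      by apply: measurable_funM => //; exact: (measurable_fun_pair2 s mFv).
    - by apply: (measurableT_comp mh); exact: measurable_rV_shift.
    - move=> x _; rewrite /h lee_fin mulr1 normrM ler_wpM2l//.
      rewrite [leLHS]ger0_norm// !indicE.
      case: (boolP (x \in _)) => [|_]; last by rewrite ler0n.
      rewrite inE /B/= => xk; rewrite mem_set//=.
      apply: (le_trans (ler_normD _ _)); rewrite lerD//.
      by rewrite normrZ ger0_norm// ler_wpM2r.
  rewrite ge0_integral_rV_shift//; last by move=> x; rewrite lee_fin mulr_ge0.
  apply: le_trans (HM s _); last by rewrite s0.
  rewrite [leRHS]integral_mkcond; under [leRHS]eq_integral do rewrite restrict_EFin.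
  apply: ge0_le_integral => //=.
  - by move=> x _; rewrite lee_fin mulr_ge0.
  - apply/measurable_EFinP; apply/(measurable_restrictT _ (mB _)).
    by apply: measurable_funTS; exact: measurableT_comp.
  - move=> x _; rewrite lee_fin indicE patchE; case: ifPn => _; first by rewrite mulr1.
    by rewrite mulr0.
have iphi : (leb1 \x leb)%E.-integrable setT (EFin \o phi).
  apply/integrable12ltyP; first exact/measurable_EFinP.
  apply: le_lt_trans
    (_ : \int[leb1]_s (M%:E * (\1_(`[0, T]%classic : set R) s)%:E) < +oo)%E.
    apply: ge0_le_integral => //=.
    - by move=> s _; exact: integral_ge0.
    - apply: (measurable_fun_fubini_tonelli_F (fun p => `|(phi p)%:E|%E)) => //.
      by apply: measurableT_comp => //; exact/measurable_EFinP.
    - apply/measurable_EFinP; apply: measurable_funM => //; exact: measurable_indic.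
    - by move=> s _; exact: phi_le.
  rewrite (_ : integral _ _ _ = (\int[leb1]_(s in `[0%R, T]) M%:E)%E).
    rewrite integral_cst//=; have /= -> := lebesgue_measure_itv `[0%R : R, T].
    case: ifP => _.
      by rewrite -EFinB -EFinM ltry.
    by rewrite mule0.
  rewrite [RHS]integral_mkcond; apply: eq_integral => s _.
  by rewrite indicE patchE; case: ifP => _; rewrite ?mule1 ?mule0.
have := ae_integrable2 iphi; apply: filterS => x ix Bx.
rewrite integrable_mkcond//; apply: eq_integrable ix => // s _ /=.
rewrite /phi restrict_EFin/= patchE indicE [in \1_(B _) _]indicE.
by rewrite (mem_set Bx) mulr1; case: ifP => _; rewrite ?mulr1 ?mulr0.
Qed.

End characteristics.

(** * Solutions written along characteristics *)

Section characteristic_solution.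
Context {R : realType} {d n : nat}.
Local Notation leb := (@lebesgue_rV R d).
Local Notation leb1 := (@lebesgue_measure R).
Local Notation space_time := (measurableTypeR R * 'rV[R]_d)%type.
Variables (v : 'I_n -> 'rV[R]_d) (mu : 'I_n -> 'I_n -> R).
Implicit Types F G H : 'I_n -> R -> 'rV[R]_d -> R.

(** Here [x] is the starting point of the characteristic, not the position at time [s]. *)
Definition exchange H (i : 'I_n) (s : R) (x : 'rV[R]_d) : R :=
  \sum_(j < n | j != i) (mu j i * H j s (x + s *: v i)
                         - mu i j * H i s (x + s *: v i)).

(* The initial datum of [mild_solution] is replaced by [H i 0]. *)
Definition characteristic_solution H : Prop :=
  [/\ forall i, measurable_fun setT (fun p : space_time => H i p.1 p.2),
      forall i T K, compact K -> exists M : R, forall t, 0 <= t <= T ->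
        (\int[leb]_(x in K) `|H i t x|%:E <= M%:E)%E
    & forall i t, 0 <= t -> {ae leb, forall x,
        H i t (x + t *: v i) =
          H i 0 x + \int[leb1]_(s in `[0, t]) exchange H i s x}].

(** At [t = 0] the integral in the mild formula vanishes, which identifies the value at time 0 of
    the jointly measurable version with the initial datum almost everywhere. *)
Lemma mild_solution_characteristic f0 f : mild_solution v mu f0 f ->
  exists H, [/\ characteristic_solution H,
    forall i t, 0 <= t -> {ae leb, forall x, H i t x = f i t x}
    & forall i, {ae leb, forall x, H i 0 x = f0 i x}].
Proof.
move=> [cf [F [mF Ff sol]]].
(* [F] is measurable over nonnegative times only; extension by zero makes it measurable on all of
   space-time. *)
pose H i s x := if 0 <= s then F i s x else 0.
have HF i s : 0 <= s -> H i s = F i s by rewrite /H => ->.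
have Hf i t : 0 <= t -> {ae leb, forall x, H i t x = f i t x}.
  by move=> t0; rewrite HF//; exact: Ff.
have H0 i : {ae leb, forall x, H i 0 x = f0 i x}.
  have := Ff i 0 (lexx 0); have := sol i 0 (lexx 0); apply: filterS2 => x.
  by rewrite set_itv1 Rintegral_set1 addr0 scale0r addr0 HF// => -> ->.
have mD : measurable [set p : space_time | (0 : R) <= p.1].
  rewrite [X in measurable X](_ : _ = fst @^-1` `[0, +oo[%classic).
    by rewrite -[X in measurable X]setTI; exact: measurable_fst.
  by apply/seteqP; split => p /=; rewrite in_itv/= andbT.
have mHi i : measurable_fun setT (fun p : space_time => H i p.1 p.2).
  rewrite (_ : (fun p => _) =
    (fun p => F i p.1 p.2) \_ [set p : space_time | (0 : R) <= p.1]).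
    by apply/(measurable_restrictT _ mD).
  apply/funext => p; rewrite patchE /H.
  by case: ifPn; case: ifPn => //; rewrite ?inE ?notin_setE//= => ->.
have mHt i t : measurable_fun setT (H i t) by exact: (measurable_fun_pair2 t (mHi i)).
exists H; split => //; split => //.
  move=> i T K cK; have [M HM] := continuous_L1loc_bounded _ _ T (cf i) cK.
  have mK := compact_measurable_rV _ cK.
  exists M => t tT; have /andP[t0 _] := tT; apply: le_trans (HM t tT).
  rewrite le_eqVlt; apply/predU1P; left; apply: ae_eq_integral => //.
  - by apply: measurable_funTS; apply/measurable_EFinP; apply: measurableT_comp.
  - apply: measurable_funTS; apply/measurable_EFinP; apply: measurableT_comp => //.
    exact: ((cf i).1 t t0).1.
  - by have := Hf i t t0; apply: filterS => x -> _.
move=> i t t0.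
(* The mild formula evaluates [f i t] at [x + t *: v i], so the null set off which [H] and [f] agree
   has to be translated. *)
have := ae_rV_shift _ (t *: v i) _ (Hf i t t0).
have := H0 i; have := sol i t t0; apply: filterS3 => x -> -> ->.
congr (_ + _); apply: eq_Rintegral => s; rewrite inE/= in_itv/= => /andP[s0 _].
by apply: eq_bigr => j _; rewrite !HF.
Qed.

Lemma integrable_exchange H (D : set R) i x : measurable D ->
  (forall j, leb1.-integrable D (fun s => (H j s (x + s *: v i))%:E)) ->
  leb1.-integrable D (fun s => (exchange H i s x)%:E).
Proof.
move=> mD iH.
rewrite (_ : (fun s => _) = fun s => (\sum_(j < n | j != i)
    ((mu j i)%:E * (H j s (x + s *: v i))%:E -
     (mu i j)%:E * (H i s (x + s *: v i))%:E))%E).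
  by apply: integrable_sum => // j _; apply: integrableB => //; exact: integrableZl.
apply/funext => s; rewrite -sumEFin; apply: eq_bigr => j _.
by rewrite EFinB !EFinM.
Qed.

Lemma characteristic_solution_integrable H i t : characteristic_solution H ->
  {ae leb, forall x, forall j,
    leb1.-integrable `[0, t] (fun s => (H j s (x + s *: v i))%:E)}.
Proof.
move=> [mH bH _]; apply: filter_forall => j.
by apply: ae_integrable_characteristic => // K cK; exact: bH.
Qed.

(** This is linearity of the system; the two integrals can be subtracted because, for a.e. [x], both
    integrands are integrable along the characteristic. *)
Lemma characteristic_solutionB F G :
  characteristic_solution F -> characteristic_solution G ->
  characteristic_solution (fun i t x => F i t x - G i t x).
Proof.
move=> cF cG; have [mF bF sF] := cF; have [mG bG sG] := cG; split.
- by move=> i; exact: measurable_funB.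
- move=> i T K cK; have [M HM] := bF i T K cK; have [N HN] := bG i T K cK.
  have mK := compact_measurable_rV _ cK.
  exists (M + N) => t tT; rewrite EFinD.
  have mFt : measurable_fun setT (F i t) by exact: (measurable_fun_pair2 t (mF i)).
  have mGt : measurable_fun setT (G i t) by exact: (measurable_fun_pair2 t (mG i)).
  apply: le_trans (leeD (HM t tT) (HN t tT)).
  rewrite -ge0_integralD//; last 2 first.
  - by apply: measurable_funTS; apply/measurable_EFinP; apply: measurableT_comp.
  - by apply: measurable_funTS; apply/measurable_EFinP; apply: measurableT_comp.
  apply: ge0_le_integral => //.
  - apply: measurable_funTS; apply/measurable_EFinP; apply: measurableT_comp => //.
    exact: measurable_funB.
  - apply: measurable_funTS; apply: emeasurable_funD;
      by apply/measurable_EFinP; apply: measurableT_comp.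
  - by move=> x _; rewrite -EFinD lee_fin ler_normB.
move=> i t t0.
have iF := characteristic_solution_integrable _ i t cF.
have iG := characteristic_solution_integrable _ i t cG.
have iFG : {ae leb, forall x, forall j,
    leb1.-integrable `[0, t] (fun s => (F j s (x + s *: v i))%:E) /\
    leb1.-integrable `[0, t] (fun s => (G j s (x + s *: v i))%:E)}.
  by apply: filterS2 iF iG => x {}iF {}iG j; split.
have := sF i t t0; have := sG i t t0; have := iFG.
apply: filterS3 => x {}iFG -> ->.
have {}iF j := (iFG j).1; have {}iG j := (iFG j).2.
rewrite [X in _ = _ + X](_ : _ =
    \int[leb1]_(s in `[0, t]) (exchange F i s x - exchange G i s x)).
  rewrite RintegralB//; [|exact: integrable_exchange|exact: integrable_exchange].
  by rewrite opprD addrACA.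
apply: eq_Rintegral => s _; rewrite /exchange -sumrB; apply: eq_bigr => j _.
by rewrite !mulrBr !opprB addrACA [RHS]addrACA [X in _ = _ + X]addrC.
Qed.

End characteristic_solution.

(** * Elementary estimates for the Gronwall argument *)

Lemma integral_expR_le (R : realType) (l t : R) : 0 < l -> 0 <= t ->
  (\int[lebesgue_measure]_(s in `[0%R, t]) (expR (l * s))%:E <=
   (expR (l * t) / l)%:E)%E.
Proof.
(* The fundamental theorem of calculus is applied on a nondegenerate interval, so [t = 0] is treated
   apart. *)
move=> l0; rewrite le_eqVlt => /predU1P[<-|t0].
  by rewrite set_itv1 integral_set1 lee_fin divr_ge0 ?expR_ge0// ltW.
pose F (s : R) := l^-1 * expR (l * s).
have dF (x : R) : is_derive x (1 : R) F (expR (l * x)).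
  have -> : expR (l * x) = l^-1 *: (expR (l * x) * l).
    by rewrite /GRing.scale/= mulrCA mulVf ?mulr1// gt_eqF.
  apply: is_deriveZ.
  have dl : is_derive x (1 : R) (fun s : R => l * s) l.
    by rewrite -[X in is_derive _ _ _ X]mulr1; apply: is_deriveZ.
  exact: (@is_derive1_comp _ expR (fun s => l * s) x _ _ (is_derive_expR _) dl).
have cF : continuous F.
  by move=> x; apply: differentiable_continuous; apply/derivable1_diffP; case: (dF x).
rewrite (@continuous_FTC2 _ _ F) => //.
- by rewrite -EFinB lee_fin /F mulrC gerBl mulr_ge0 ?expR_ge0// invr_ge0 ltW.
- apply: continuous_subspaceT => x; apply: continuous_comp.
    exact: mulrl_continuous.
  exact: continuous_expR.
- split.
  + by move=> x _; case: (dF x).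
  + exact/cvg_at_right_filter/cF.
  + exact/cvg_at_left_filter/cF.
- by move=> x _; rewrite derive1E; case: (dF x).
Qed.

(** If [x] were positive, [k < 2 ^ k] would give [x * k <= c] for all [k], against the Archimedean
    property. *)
Lemma le0_of_le_geometric (R : realType) (x c : R) :
  (forall k, x <= c / 2 ^+ k) -> x <= 0.
Proof.
move=> H; rewrite leNgt; apply/negP => x0.
have xk (k : nat) : x * k%:R <= c.
  have := H k; rewrite ler_pdivlMr ?exprn_gt0//; apply: le_trans.
  by rewrite ler_pM2l// -natrX ler_nat ltnW// ltn_expl.
have := xk (Num.truncn (c / x)).+1; rewrite mulrC -ler_pdivlMr//.
by rewrite leNgt truncnS_gt.
Qed.

(** * Positivity of solutions with nonnegative initial data *)

Section positivity_characteristic.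
Context {R : realType} {d n : nat}.
Local Notation leb := (@lebesgue_rV R d).
Local Notation leb1 := (@lebesgue_measure R).
Local Notation space_time := (measurableTypeR R * 'rV[R]_d)%type.
Local Notation neg x := (Num.max (- x) 0).
Variables (v : 'I_n -> 'rV[R]_d) (mu : 'I_n -> 'I_n -> R).
Hypothesis mu_ge0 : forall i j, i != j -> 0 <= mu i j.
Variable H : 'I_n -> R -> 'rV[R]_d -> R.
Hypothesis solH : characteristic_solution v mu H.
Hypothesis H0_ge0 : forall i, {ae leb, forall x, 0 <= H i 0 x}.

Let mH i : measurable_fun setT (fun p : space_time => H i p.1 p.2).
Proof. by have [] := solH. Qed.

Lemma measurable_exchange i :
  measurable_fun setT (fun p : space_time => exchange v mu H i p.1 p.2).
Proof.
rewrite /exchange; under eq_fun do rewrite -big_filter.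
apply: measurable_sum => j; apply: measurable_funB; apply: measurable_funM => //.
  exact: (measurable_along_characteristic _ (v i) (mH j)).
exact: (measurable_along_characteristic _ (v i) (mH i)).
Qed.

(** The solution formula holds for each [s] off a null set of [x] depending on [s], whereas the
    scalar inequality fixes [x] and lets [s] vary. [ae_ae_swap] exchanges the quantifiers; the work
    lies in the measurability of the set where the formula holds. *)
Lemma ae_characteristic_formula i :
  {ae leb, forall x, {ae leb1, forall s, 0 <= s ->
    H i s (x + s *: v i) =
      H i 0 x + \int[leb1]_(r in `[0, s]) exchange v mu H i r x}}.
Proof.
pose Phi (p : space_time) : R :=
  H i 0 p.2 + \int[leb1]_(r in `[0, p.1]) exchange v mu H i r p.2.
have mPhi : measurable_fun setT Phi.
  apply: measurable_funD.
    apply: (measurableT_comp _ measurable_snd).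
    exact: (measurable_fun_pair2 (0 : measurableTypeR R) (mH i)).
  (* The variable upper bound of integration becomes an indicator function, so that
     [measurable_Rintegral_snd] applies. *)
  pose D := [set q : space_time * measurableTypeR R | 0 <= (q.2 : R) <= q.1.1].
  have mD : measurable D.
    rewrite (_ : D = (fun q : space_time * measurableTypeR R =>
        (0 <= (q.2 : R)) && ((q.2 : R) <= q.1.1)) @^-1` [set true]).
      rewrite -[X in measurable X]setTI; apply: measurable_and => //.
        by apply: measurable_fun_ler; [exact: measurable_cst|exact: measurable_snd].
      apply: measurable_fun_ler; first exact: measurable_snd.
      exact: (measurableT_comp measurable_fst measurable_fst).
    by apply/seteqP; split => q.
  pose h (q : space_time * measurableTypeR R) : R :=
    exchange v mu H i q.2 q.1.2 * \1_D q.
  have mh : measurable_fun setT h.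
    apply: measurable_funM; last exact: measurable_indic.
    apply: (measurableT_comp (measurable_exchange i)
      (g := fun q : space_time * measurableTypeR R => (q.2, q.1.2))).
    apply/measurable_fun_pairP; split; first exact: measurable_snd.
    exact: (measurableT_comp measurable_snd measurable_fst).
  rewrite (_ : (fun p => _) = fun p => \int[leb1]_r h (p, r)).
    exact: measurable_Rintegral_snd.
  apply/funext => p; rewrite Rintegral_mkcond; apply: eq_Rintegral => r _.
  rewrite /h patchE indicE /D; case: ifPn.
    by rewrite inE/= in_itv/= => rI; rewrite mem_set// mulr1.
  rewrite notin_setE/= in_itv/= => rI; rewrite memNset ?mulr0//.
(* Negative times are put into [B] because [ae_ae_swap] ranges over all real [s], while the formula
   is available for [0 <= s]. *)
pose B := [set p : space_time | (p.1 : R) < 0] `|`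
  [set p : space_time | H i p.1 (p.2 + (p.1 : R) *: v i) = Phi p].
have mB : measurable B.
  apply: measurableU.
    rewrite [X in measurable X](_ : _ = fst @^-1` `]-oo, 0[%classic).
      by rewrite -[X in measurable X]setTI; exact: measurable_fst.
    by apply/seteqP; split => p /=; rewrite in_itv/=.
  rewrite (_ : mkset _ = (fun p : space_time =>
      H i p.1 (p.2 + (p.1 : R) *: v i) == Phi p) @^-1` [set true]).
    rewrite -[X in measurable X]setTI; apply: measurable_fun_eqr => //.
    exact: (measurable_along_characteristic _ (v i) (mH i)).
  by apply/seteqP; split => p /= /eqP.
suff : {ae leb, forall x, {ae leb1, forall s, B (s, x)}}.
  apply: filterS => x; apply: filterS => s [/= s0|//]; by rewrite leNgt s0.
apply: ae_ae_swap => //; apply: aeW => s.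
have [s0|s0] := ltP s 0; first by apply: aeW => x; left.
have [_ _ /(_ i s s0)] := solH.
by apply: filterS => x Hx; right.
Qed.

(** This takes the role of [p] in [opp_integral_le_of_damping]. *)
Let gain_neg i s x := \sum_(j < n | j != i) mu j i * neg (H j s (x + s *: v i)).

Let gain_neg_ge0 i s x : 0 <= gain_neg i s x.
Proof.
by apply: sumr_ge0 => j ji; rewrite mulr_ge0 ?mu_ge0// le_max lexx orbT.
Qed.

(** Apply [opp_integral_le_of_damping] to [H i] along the characteristic, with the total loss rate
    as [l]: bounding each [H j] in the gain from below by minus its negative part gives the required
    lower bound on [exchange]. *)
Lemma neg_along_characteristic i t : 0 <= t ->
  {ae leb, forall x, (neg (H i t (x + t *: v i)))%:E <=
    \int[leb1]_(s in `[0%R, t]) (gain_neg i s x)%:E}%E.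
Proof.
move=> t0; have [_ _ formula] := solH.
have int_ae := characteristic_solution_integrable _ _ _ i t solH.
have at_t : {ae leb, forall x, 0 <= H i 0 x /\ H i t (x + t *: v i) =
    H i 0 x + \int[leb1]_(s in `[0, t]) exchange v mu H i s x}.
  by have := formula i t t0; have := H0_ge0 i; apply: filterS2 => x; split.
have := ae_characteristic_formula i; have := int_ae; have := at_t.
apply: filterS3 => x [Hx0 ->] iH Hs.
have ie : leb1.-integrable `[0, t] (EFin \o (fun s => exchange v mu H i s x)).
  exact: integrable_exchange.
have ip : leb1.-integrable `[0, t] (EFin \o (fun s => gain_neg i s x)).
  rewrite (_ : _ \o _ = fun s => (\sum_(j < n | j != i)
      ((mu j i)%:E * ((fun s => (H j s (x + s *: v i))%:E)^\- s)))%E).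
    apply: integrable_sum => // j _; apply: integrableZl => //.
    exact: integrable_funeneg.
  apply/funext => s; rewrite /= -sumEFin; apply: eq_bigr => j _.
  by rewrite EFinM funenegE/= -EFin_max.
rewrite -[leRHS]fineK; last exact: integrable_fin_num.
rewrite lee_fin ge_max; apply/andP; split; last first.
  by apply: Rintegral_ge0 => s _; exact: gain_neg_ge0.
apply: (opp_integral_le_of_damping _ _ (\sum_(j < n | j != i) mu i j)) => //.
  by apply: sumr_ge0 => j ji; rewrite mu_ge0// eq_sym.
(* For almost every [s], the initial value plus the integral up to [s] is the value of [H i s] on
   the characteristic. *)
move: Hs; apply: (@filterS _ (almost_everywhere leb1)
  (ae_filter_ringOfSetsType leb1)) => s Hs.
rewrite /= in_itv/= => /andP[s0 _]; rewrite -Hs//.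
rewrite /exchange sumrB -mulr_suml lerD2r -sumrN; apply: ler_sum => j ji.
by rewrite -mulrN ler_wpM2l ?mu_ge0// lerNl le_max lexx.
Qed.

(* The substitution [z = x + s *: v i] turns the region [A] at time [t], seen
   along the i-th characteristics, into [A - (t - s) *: v i] at time [s]. *)
Lemma integral_neg_le i t (A : set 'rV[R]_d) (b : R -> R) : 0 <= t ->
  measurable A -> measurable_fun setT b -> (forall s, 0 <= b s) ->
  (forall s j, (0 <= s <= t)%R ->
    \int[leb]_(z in [set z | A (z + (t - s) *: v i)%R]) (neg (H j s z))%:E <=
    (b s)%:E)%E ->
  (\int[leb]_(x in A) (neg (H i t x))%:E <=
   \int[leb1]_(s in `[0%R, t]) ((\sum_(j < n | j != i) mu j i) * b s)%:E)%E.
Proof.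
move=> t0 mA mb b0 Hb.
have neg_ge0 (y : R) : 0 <= neg y by rewrite le_max lexx orbT.
have mneg j s : measurable_fun setT (fun x => neg (H j s x)).
  apply: measurable_maxr => //; apply: measurable_funN.
  exact: (measurable_fun_pair2 (s : measurableTypeR R) (mH j)).
have mAw w : measurable [set z : 'rV[R]_d | A (z + w)].
  by rewrite -[X in measurable X]setTI; exact: measurable_rV_shift.
(* Extension by zero outside [A] gives an integral over the whole space, which can be translated by
   [t *: v i]. *)
pose g x := ((fun x => (neg (H i t x))%:E) \_ A) x.
have mg : measurable_fun setT g.
  apply/(measurable_restrictT _ mA); apply: measurable_funTS.
  exact/measurable_EFinP.
have g0 x : (0 <= g x)%E.
  by rewrite /g patchE; case: ifPn => // _; rewrite lee_fin neg_ge0.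
rewrite integral_mkcond -(ge0_integral_rV_shift _ (t *: v i) _ mg g0).
pose At := [set z : 'rV[R]_d | A (z + t *: v i)].
pose It : set R := `[0, t]%classic.
have mAt : measurable At by exact: mAw.
have mIt : measurable (It : set (measurableTypeR R)) by exact: measurable_itv.
(* The two indicators turn the double integral over [[0, t]] and [At] into one over the whole
   product, ready for Tonelli's theorem. *)
pose q (p : space_time) : \bar R :=
  (\sum_(j < n | j != i) mu j i * neg (H j p.1 (p.2 + (p.1 : R) *: v i))
    * \1_It p.1 * \1_At p.2)%:E.
have q0 p : (0 <= q p)%E.
  rewrite lee_fin; apply: sumr_ge0 => j ji.
  by rewrite !mulr_ge0 ?mu_ge0// neg_ge0.
have mq : measurable_fun setT q.
  apply/measurable_EFinP; under eq_fun do rewrite -big_filter.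
  apply: measurable_sum => j; apply: measurable_funM.
    apply: measurable_funM; last first.
      by apply: (measurableT_comp _ measurable_fst); exact: measurable_indic.
    apply: measurable_funM => //; apply: measurable_maxr => //.
    apply: measurable_funN.
    exact: (measurable_along_characteristic _ (v i) (mH j)).
  by apply: (measurableT_comp _ measurable_snd); exact: measurable_indic.
apply: (@le_trans _ _ (\int[leb]_x \int[leb1]_s q (s, x))%E).
  apply: ae_ge0_le_integral => //.
  - by apply: (measurableT_comp mg); exact: measurable_rV_shift.
  - by move=> x _; exact: integral_ge0.
  - exact: (measurable_fun_fubini_tonelli_G _ mq).
  have := neg_along_characteristic i t t0.
  apply: filterS => x Hx _; rewrite /g patchE.
  case: ifPn => [xA|_]; last exact: integral_ge0.
  apply: (le_trans Hx); rewrite integral_mkcond le_eqVlt; apply/predU1P; left.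
  have xAt : At x by exact: set_mem.
  apply: eq_integral => s _; rewrite patchE /q/= [\1_At _]indicE (mem_set xAt).
  rewrite [\1_It _]indicE -/It; case: ifPn => _; congr (_%:E).
    by apply: eq_bigr => j _; rewrite !mulr1.
  by rewrite big1// => j _; rewrite mulr0 mul0r.
(* After the exchange of the integrals, the integrands in [s] are compared pointwise. *)
rewrite -(fubini_tonelli q mq q0) [leRHS]integral_mkcond.
have b_ge0 s : 0 <= (\sum_(j < n | j != i) mu j i) * b s.
  by rewrite mulr_ge0//; apply: sumr_ge0 => j ji; exact: mu_ge0.
apply: ge0_le_integral => //.
- by move=> s _; exact: integral_ge0.
- exact: (measurable_fun_fubini_tonelli_F _ mq).
- apply/(measurable_restrictT _ mIt); apply: measurable_funTS; apply/measurable_EFinP.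
  by apply: measurable_funM.
move=> s _; rewrite patchE; case: ifPn => [|sI]; last first.
  rewrite integral0_eq// => x _; rewrite /q/= big1// => j _.
  by rewrite [\1_It _]indicE (negbTE sI) mulr0 mul0r.
rewrite inE/= in_itv/= => sI.
(* [mu i i] is unconstrained, hence possibly negative. *)
pose m j : R := if j != i then mu j i else 0.
have m0 j : 0 <= m j by rewrite /m; case: ifPn => // ji; exact: mu_ge0.
have sum_m (a : 'I_n -> R) :
    \sum_(j < n | j != i) mu j i * a j = \sum_(j < n) m j * a j.
  rewrite big_mkcond; apply: eq_bigr => j _.
  by rewrite /m; case: ifPn; rewrite ?mul0r.
(* The cut-off in [k] is the region at time [s]: [x] lies in [At] exactly when [x + s *: v i] lies
   in that region. *)
pose k j z := (neg (H j s z) *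
  \1_[set z : 'rV[R]_d | A (z + (t - s) *: v i)%R] z)%:E.
have k0 j z : (0 <= k j z)%E by rewrite lee_fin mulr_ge0// neg_ge0.
have mk j : measurable_fun setT (k j).
  by apply/measurable_EFinP; apply: measurable_funM => //; exact: measurable_indic.
rewrite (_ : integral _ _ _ =
    \int[leb]_x (\sum_(j < n) (m j)%:E * k j (x + s *: v i)%R))%E; last first.
  apply: eq_integral => x _; rewrite /q/=; under eq_bigr do rewrite -!mulrA.
  rewrite sum_m -sumEFin; apply: eq_bigr => j _.
  rewrite EFinM /k [\1_It _]indicE (mem_set (_ : It s)) ?mul1r; last first.
    by rewrite /It/= in_itv.
  have Ew : x + s *: v i + (t - s) *: v i = x + t *: v i.
    by rewrite -addrA -scalerDl (addrC s) subrK.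
  congr (_ * (_ * _)%:E)%E; rewrite !indicE; congr (nat_of_bool _)%:R.
  by apply/idP/idP => /set_mem h; apply/mem_set; move: h; rewrite /At/= Ew.
rewrite ge0_integral_sum//; last 2 first.
- move=> j; apply: emeasurable_funM => //.
  by apply: (measurableT_comp (mk j)); exact: measurable_rV_shift.
- by move=> j x _; rewrite mule_ge0// lee_fin.
rewrite mulr_suml sum_m -sumEFin; apply: lee_sum => j _.
rewrite ge0_integralZl_EFin//; last first.
  by apply: (measurableT_comp (mk j)); exact: measurable_rV_shift.
rewrite EFinM lee_pmul ?integral_ge0//; first by rewrite lee_fin.
rewrite (ge0_integral_rV_shift _ (s *: v i) (k j))//; apply: le_trans (Hb s j sI).
rewrite [leRHS]integral_mkcond le_eqVlt; apply/predU1P; left.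
apply: eq_integral => z _.
by rewrite /k patchE indicE; case: ifPn => _; rewrite ?mulr1 ?mulr0.
Qed.

(** Gronwall's argument is carried out by iteration: each use of [integral_neg_le] halves the
    constant in an exponentially weighted bound on the integrals over shrinking balls, so at time
    [T] these integrals vanish. *)
Lemma characteristic_solution_ge0 i T : 0 <= T ->
  {ae leb, forall x, 0 <= H i T x}.
Proof.
move=> T0; have [_ bH _] := solH.
have neg_ge0 (y : R) : 0 <= neg y by rewrite le_max lexx orbT.
have mHt j s : measurable_fun setT (H j s).
  exact: (measurable_fun_pair2 (s : measurableTypeR R) (mH j)).
have mneg j s : measurable_fun setT (fun x => neg (H j s x)).
  by apply: measurable_maxr => //; exact: measurable_funN.
pose V := \sum_(j < n) `|v j|.
have vV j : `|v j| <= V by rewrite /V (bigD1 j)//= lerDl sumr_ge0.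
have V0 : 0 <= V by exact: sumr_ge0.
pose S j := \sum_(k < n | k != j) mu k j.
have S0 j : 0 <= S j by apply: sumr_ge0 => k kj; exact: mu_ge0.
(* [C] dominates every [S j]; the summand 1 keeps it positive when all rates vanish, since it ends
   up in a denominator. *)
pose C := 1 + \sum_(j < n) S j.
have C0 : 0 < C by rewrite ltr_pwDl// sumr_ge0.
have SC j : S j <= C.
  by rewrite /C (bigD1 j)//= addrCA lerDl addr_ge0// sumr_ge0.
(* The ball shrinks at speed [V], a bound on the speed of propagation, so that
   [K r t - (t - s) *: v j] is contained in [K r s] for [s <= t]. *)
pose K r s := [set x : 'rV[R]_d | `|x| <= r + V * (T - s)].
have mK r s : measurable (K r s).
  by apply: compact_measurable_rV; exact: norm_ball_compact.
(* The weight [expR (2 * C * s)] makes the Duhamel operator a contraction of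
   ratio 1/2. *)
have decay (r : R) : exists M : R, forall k j s, 0 <= s <= T ->
    (\int[leb]_(x in K r s) (neg (H j s x))%:E <=
     (M / 2 ^+ k * expR (2 * C * s))%:E)%E.
  (* This ball is [K r 0], the largest of the family, so its bound serves at all times in
     [[0, T]]. *)
  have /choice[M HM] j := bH j T _ (norm_ball_compact (r + V * (T - 0))).
  exists (\sum_j `|M j|).
  have M0 : 0 <= \sum_j `|M j| by exact: sumr_ge0.
  elim=> [|k IH] j s sT; have /andP[s0 sT'] := sT.
    rewrite expr0 divr1.
    apply: (@le_trans _ _ (M j)%:E).
      apply: le_trans (HM j s sT).
      apply: (@le_trans _ _ (\int[leb]_(x in K r s) `|H j s x|%:E)%E).
        apply: ge0_le_integral => //.
        - by move=> x _; rewrite lee_fin neg_ge0.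
        - by apply: measurable_funTS; exact/measurable_EFinP.
        - by apply: measurable_funTS; apply/measurable_EFinP; exact: measurableT_comp.
        - by move=> x _; rewrite lee_fin ge_max normr_ge0 andbT -normrN ler_norm.
      apply: ge0_subset_integral => //; first exact: mK.
      - by apply: measurable_funTS; apply/measurable_EFinP; exact: measurableT_comp.
      - move=> x /= xK; apply: (le_trans xK).
        by rewrite lerD2l ler_wpM2l// lerB.
    rewrite lee_fin; apply: (@le_trans _ _ (\sum_j `|M j|)).
      by rewrite (bigD1 j)//= (le_trans (ler_norm _))// lerDl sumr_ge0.
    by rewrite ler_peMr// -expR0 ler_expR !mulr_ge0// ltW.
  pose N := (\sum_j `|M j|) / 2 ^+ k.
  have N0 : 0 <= N by rewrite divr_ge0// exprn_ge0.
  pose b (r : R) := N * expR (2 * C * r).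
  have b0 r' : 0 <= b r' by rewrite mulr_ge0 ?expR_ge0.
  have mb : measurable_fun setT b.
    apply: measurable_funM => //; apply: (measurableT_comp (@measurable_expR R)).
    exact: measurable_funM.
  apply: (le_trans (integral_neg_le j s _ b s0 (mK r s) mb b0 _)).
    move=> u l /andP[u0 us]; have uT : 0 <= u <= T by rewrite u0 (le_trans us).
    apply: le_trans (IH l u uT); apply: ge0_subset_integral => //.
    - by rewrite -[X in measurable X]setTI; exact: measurable_rV_shift.
    - by apply: measurable_funTS; exact/measurable_EFinP.
    - by move=> x _; rewrite lee_fin neg_ge0.
    move=> x /= xK; rewrite -[x](addrK ((s - u) *: v j)) /K/=.
    apply: (le_trans (ler_normB _ _)); apply: (le_trans (lerD xK (lexx _))).
    rewrite -addrA lerD2l normrZ ger0_norm ?subr_ge0//.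
    apply: (@le_trans _ _ (V * (T - s) + (s - u) * V)).
      by rewrite lerD2l ler_wpM2l// subr_ge0.
    by rewrite [_ * V]mulrC -mulrDr addrA subrK.
  have Sb0 u : 0 <= S j * b u by rewrite mulr_ge0.
  apply: (@le_trans _ _ (\int[leb1]_(u in `[0%R, s])
      ((C * N)%:E * (expR (2 * C * u))%:E))%E).
    apply: ge0_le_integral => //.
    - by move=> u _; rewrite lee_fin Sb0.
    - by apply: measurable_funTS; apply/measurable_EFinP; exact: measurable_funM.
    - apply: measurable_funTS; apply/measurable_EFinP; apply: measurable_funM => //.
      by apply: (measurableT_comp (@measurable_expR R)); exact: measurable_funM.
    - move=> u _; rewrite -EFinM lee_fin /b mulrA ler_wpM2r ?expR_ge0//.
      by rewrite ler_wpM2r//; exact: SC.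
  have CN0 : 0 <= C * N by rewrite mulr_ge0// ltW.
  have mexp : measurable_fun (`[0, s]%classic : set (measurableTypeR R))
      (fun u => (expR (2 * C * u))%:E).
    apply: measurable_funTS; apply/measurable_EFinP.
    by apply: (measurableT_comp (@measurable_expR R)); exact: measurable_funM.
  rewrite ge0_integralZl_EFin//.
  have C20 : 0 < 2 * C by rewrite mulr_gt0.
  apply: (le_trans (lee_wpmul2l _ (integral_expR_le _ _ _ C20 s0))).
    by rewrite lee_fin mulr_ge0// ltW.
  (* The factor [C] from the rates cancels against [1 / (2 * C)] from the integral of the
     exponential, which leaves the gain of 1/2. *)
  rewrite -EFinM lee_fin le_eqVlt; apply/predU1P; left.
  rewrite exprSr [in RHS]invfM (mulrA (\sum_j _)) -/N.
  by field; rewrite gt_eqF.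
(* At time [T] the set [K k%:R T] is the ball of radius [k], and these balls cover the space. *)
suff HB (k : nat) : {ae leb, forall x, `|x| <= k%:R -> 0 <= H i T x}.
  have := @ae_foralln _ _ _ leb _ HB.
  by apply: filterS => x /(_ (Num.truncn `|x|).+1); apply; rewrite ltW// truncnS_gt.
have [M HM] := decay k%:R.
have TT : 0 <= T <= T by rewrite T0 lexx.
have I0 : (\int[leb]_(x in K k%:R T) `|(neg (H i T x))%:E| = 0)%E.
  under eq_integral do rewrite gee0_abs ?lee_fin ?neg_ge0//.
  have I_ge0 : (0 <= \int[leb]_(x in K k%:R T) (neg (H i T x))%:E)%E.
    by apply: integral_ge0 => x _; rewrite lee_fin neg_ge0.
  have If : (\int[leb]_(x in K k%:R T) (neg (H i T x))%:E)%E \is a fin_num.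
    by rewrite ge0_fin_numE//; exact: le_lt_trans (HM 0%N i T TT) (ltry _).
  rewrite -(fineK If); congr (_%:E); apply/eqP; rewrite eq_le fine_ge0// andbT.
  apply: (@le0_of_le_geometric _ _ (M * expR (2 * C * T))) => l.
  by rewrite -lee_fin (fineK If) mulrAC; exact: HM.
have mn : measurable_fun (K k%:R T) (fun x => (neg (H i T x))%:E).
  by apply: measurable_funTS; exact/measurable_EFinP.
have /(ae_eq_integral_abs _ (mK k%:R T) mn) := I0.
apply: filterS => x /= Hx xk.
have /Hx : K k%:R T x by rewrite /K/= subrr mulr0 addr0.
by move=> [/eqP]; rewrite eq_le ge_max lexx andbT oppr_le0 => /andP[].
Qed.

End positivity_characteristic.

(** * Comparison of two solutions *)

Theorem corollary2p2 (R : realType) (d n : nat) (hd : (1 <= d)%N)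
    (hn : (1 <= n)%N)
    (v : 'I_n -> 'rV[R]_d) (mu : 'I_n -> 'I_n -> R)
    (mu_ge0 : forall i j, i != j -> 0 <= mu i j)
    (mu_sym : forall i j, i != j -> mu i j = mu j i)
    (f0 g0 : 'I_n -> 'rV[R]_d -> R) (f g : 'I_n -> R -> 'rV[R]_d -> R)
    (hf : mild_solution v mu f0 f) (hg : mild_solution v mu g0 g)
    (h0 : forall i, {ae lebesgue_rV d, forall x, f0 i x <= g0 i x}) :
  forall t : R, 0 < t -> forall i,
    {ae lebesgue_rV d, forall x, f i t x <= g i t x}.
Proof.
move=> t t0 i.
have [F [cF Ff F0]] := mild_solution_characteristic _ _ _ _ hf.
have [G [cG Gg G0]] := mild_solution_characteristic _ _ _ _ hg.
(* By linearity, the positivity result is applied to the difference of [G] and [F]. *)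
have GF0 j : {ae lebesgue_rV d, forall x, 0 <= G j 0 x - F j 0 x}.
  have := h0 j; have := G0 j; have := F0 j.
  by apply: filterS3 => x -> ->; rewrite subr_ge0.
have := characteristic_solution_ge0 _ _ mu_ge0 _
  (characteristic_solutionB _ _ _ _ cG cF) GF0 i t (ltW t0).
have := Gg i t (ltW t0); have := Ff i t (ltW t0).
by apply: filterS3 => x -> ->; rewrite subr_ge0.
Qed.
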